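(* For every positive integer $n$, $$\mathrm{ex}(n,\mathbf A\mathbf C\mathbf D)=\left\lfloor\tfrac14(n-1)^2\right\rfloor,$$ and a triple system $\mathcal F$ on $n$ vertices containing none of $\mathbf A,\mathbf C,\mathbf D$ attains equality, $|\mathcal F|=\lfloor\frac14(n-1)^2\rfloor$, if and only if it is of the form $\mathcal F_T$ for the transitive tournament $T$.
   Context: A triple system on a finite vertex set $V$, $|V|=n$, is a family $\mathcal F$ of distinct $3$-element subsets (triples) of $V$. We write $123$ for $\{1,2,3\}$ etc. $\mathbf A=\{124,135,236\}$ (on 6 vertices), $\mathbf C=\{124,134,234\}$ (on 4 vertices) and $\mathbf D=\{123,134,235\}$ (on 5 vertices). A triple system contains a configuration if some of its triples form a system isomorphic to it (not necessarily induced). $\mathrm{ex}(n,X_1\dots X_k)$ denotes the maximum number of triples in a triple system on $n$ vertices that contains none of $X_1,\dots,X_k$. Tournament construction $\mathcal F_T$: take a maximum size matching (i.e. $\lfloor n/2\rfloor$ pairwise disjoint pairs) in the complete graph on the $n$-element vertex set, and a tournament $T$ whose vertices are these $\lfloor n/2\rfloor$ pairs. $\mathcal F_T$ consists of all triples $e\cup\{v\}$ where $e$ is a matching pair and $v$ belongs to another matching pair $e'$ such that $T$ has the arc $e\to e'$; and, if $n$ is odd, also all triples $e\cup\{u\}$ where $e$ is a matching pair and $u$ is the unique unmatched vertex. The tournament $T$ is transitive if its arc relation is a strict linear order on the matching pairs. *)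

(* Defs.v *)
From mathcomp Require Import all_boot.
Set Implicit Arguments.
Unset Strict Implicit.
Unset Printing Implicit Defensive.

Definition triple_system (V : finType) (F : {set {set V}}) : bool :=
  [forall e in F, #|e| == 3].

(* A fixed triple system on the vertex set 'I_(config_order X). *)
Record config := Config {
  config_order : nat;
  config_triples : {set {set 'I_config_order}} }.

(* Every vertex of the configurations below lies in one of their triples, so
   an isomorphism onto a subfamily of F is exactly an injection of vertices
   sending triples to members of F. *)
Definition contains (V : finType) (F : {set {set V}}) (X : config) : bool :=
  [exists f : {ffun 'I_(config_order X) -> V},
     injectiveb f &&
     ([set f @: (e : {set _}) | e in config_triples X] \subset F)].

Definition avoids (V : finType) (F : {set {set V}}) (Xs : seq config) : bool :=
  all (fun X => ~~ contains F X) Xs.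

(* The vertex labelled i, with 1 <= i <= k, is the ordinal i - 1 of 'I_k. *)
Definition triple (k a b c : nat) : {set 'I_k} :=
  [set i : 'I_k | i.+1 \in [:: a; b; c]].

Definition config_A : config :=
  @Config 6 [set triple 6 1 2 4; triple 6 1 3 5; triple 6 2 3 6].

Definition config_C : config :=
  @Config 4 [set triple 4 1 2 4; triple 4 1 3 4; triple 4 2 3 4].

Definition config_D : config :=
  @Config 5 [set triple 5 1 2 3; triple 5 1 3 4; triple 5 2 3 5].

Definition turan_ex (n : nat) (Xs : seq config) : nat :=
  \max_(F : {set {set 'I_n}} | triple_system F && avoids F Xs) #|F|.

Definition maximum_matching (V : finType) (M : {set {set V}}) : bool :=
  [&& [forall e in M, #|e| == 2], trivIset M & #|M| == #|V| %/ 2].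

(* Only the values of T on M matter: the vertices of the tournament are the
   pairs in M, and T e e' stands for the arc e -> e'. *)
Definition tournament (V : finType) (M : {set {set V}}) (T : rel {set V}) :
    Prop :=
  {in M, forall e, ~~ T e e} /\
  {in M &, forall e e', e != e' -> T e e' = ~~ T e' e}.

Definition transitive_tournament (V : finType) (M : {set {set V}})
    (T : rel {set V}) : Prop :=
  tournament M T /\ {in M & &, transitive T}.

Definition tournament_system (V : finType) (M : {set {set V}})
    (T : rel {set V}) : {set {set V}} :=
  [set v |: e | e in M,
                v in [set v | [exists e' in M, T e e' && (v \in e')]
                              || (odd #|V| && (v \notin cover M))]].

(* Main.v *)
Require Import Defs.
From mathcomp Require Import all_boot zify.
Set Implicit Arguments.
Unset Strict Implicit.
Unset Printing Implicit Defensive.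

(** If a triple shares two of its three pairs with other triples, then these
    three triples form a copy of C (when the two further vertices coincide) or
    of D (when they differ).  So a triple system F avoids C and D exactly when
    each triple e has a base, a pair b e inside e, such that the two other
    pairs of e lie in no triple but e ([exists_base_function],
    [base_function_avoids]).  Say that e owns these two pairs.

    Each triple owns two pairs and no pair has two owners, so the set R of the
    pairs without an owner satisfies |R| + 2|F| = C(n,2) ([card_unowned]), and
    the upper bound on |F| amounts to |R| >= floor(n/2).  Every base is in R.
    If no pair of R contains u, then each pair uw is owned by some triple, whose
    apex must be u, so that w is in its base: hence R covers every vertex but u
    ([leq_cover_unowned]).  Thus R always covers n - 1 vertices, and it has at
    least (n - 1)/2 pairs.

    If |R| = floor(n/2), then R is a maximum matching.  For n even this needs
    that R misses no vertex: the bases of the triples with a missed apex u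
    would partition the n - 1 other vertices into pairs.  Every pair outside R
    has one owner, whose base is in R; reading this for the four pairs between
    two members of R shows that F is the system of a tournament on R, and a
    cyclic triangle of this tournament would be a copy of A
    ([unowned_tournament_system], [arrow_transitive]).

    Conversely, the matching pair inside each triple of a tournament system is
    a base of that triple, and R is then the matching: this gives both the
    absence of C and D and the number of triples.  A copy of A would yield a
    cyclic triangle of the tournament ([tournament_avoids_A]). *)

(** * Copies of the configurations *)

Section Configurations.
Variables (V : finType) (F : {set {set V}}).

Lemma containsP (k : nat) (Ts : {set {set 'I_k}}) :
  reflect (exists2 s : k.-tuple V, uniq s &
             {in Ts, forall t : {set 'I_k}, tnth s @: t \in F})
          (contains F (Config Ts)).
Proof.
apply: (iffP existsP) => [[f /andP[/injectiveP f_inj /subsetP sub]] | [s Us sub]].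
  exists [tuple f i | i < k].
    by rewrite map_inj_uniq ?val_ord_tuple ?enum_uniq.
  move=> t tTs; have -> : tnth [tuple f i | i < k] @: t = f @: t.
    by apply: eq_imset => i; rewrite tnth_mktuple.
  by apply: sub; apply: imset_f.
have /tuple_uniqP s_inj := Us.
exists [ffun i => tnth s i]; apply/andP; split.
  by apply/injectiveP => i j; rewrite !ffunE => /s_inj.
apply/subsetP => _ /imsetP[t tTs ->].
have -> : [ffun i => tnth s i] @: t = tnth s @: t.
  by apply: eq_imset => i; rewrite ffunE.
exact: sub.
Qed.

(** The labels of [triple] start at 1, the positions in a sequence at 0. *)
Lemma imset_triple (x0 : V) (k : nat) (s : k.-tuple V) (a b c : nat) :
    a < k -> b < k -> c < k ->
  tnth s @: triple k a.+1 b.+1 c.+1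
  = [set nth x0 s a; nth x0 s b; nth x0 s c].
Proof.
move=> ak bk ck.
have -> : triple k a.+1 b.+1 c.+1
          = [set Ordinal ak; Ordinal bk; Ordinal ck].
  by apply/setP => i; rewrite !inE !eqSS -!val_eqE /= orbA.
by rewrite !(imsetU, imset_set1) !(tnth_nth x0).
Qed.

Lemma contains_AP :
  reflect (exists a b c d e f,
             [/\ uniq [:: a; b; c; d; e; f], [set a; b; d] \in F,
                 [set a; c; e] \in F & [set b; c; f] \in F])
          (contains F config_A).
Proof.
apply: (iffP (containsP _)) => [[s] | [a [b [c [d [e [f [U abd ace bcf]]]]]]]].
  case/tupleP: s => a s; case/tupleP: s => b s; case/tupleP: s => c s.
  case/tupleP: s => d s; case/tupleP: s => e s; case/tupleP: s => f s.
  rewrite (tuple0 s) => U sub; exists a, b, c, d, e, f; split=> //.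
  - have := sub (triple 6 1 2 4); rewrite (imset_triple a) //=; apply.
    by rewrite !inE eqxx.
  - have := sub (triple 6 1 3 5); rewrite (imset_triple a) //=; apply.
    by rewrite !inE eqxx ?orbT.
  - have := sub (triple 6 2 3 6); rewrite (imset_triple a) //=; apply.
    by rewrite !inE eqxx ?orbT.
exists [tuple a; b; c; d; e; f] => // t; rewrite !inE -orbA.
by case/or3P=> /eqP->; rewrite (imset_triple a).
Qed.

Lemma contains_CP :
  reflect (exists a b c d,
             [/\ uniq [:: a; b; c; d], [set a; b; d] \in F,
                 [set a; c; d] \in F & [set b; c; d] \in F])
          (contains F config_C).
Proof.
apply: (iffP (containsP _)) => [[s] | [a [b [c [d [U abd acd bcd]]]]]].
  case/tupleP: s => a s; case/tupleP: s => b s; case/tupleP: s => c s.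
  case/tupleP: s => d s.
  rewrite (tuple0 s) => U sub; exists a, b, c, d; split=> //.
  - have := sub (triple 4 1 2 4); rewrite (imset_triple a) //=; apply.
    by rewrite !inE eqxx.
  - have := sub (triple 4 1 3 4); rewrite (imset_triple a) //=; apply.
    by rewrite !inE eqxx ?orbT.
  - have := sub (triple 4 2 3 4); rewrite (imset_triple a) //=; apply.
    by rewrite !inE eqxx ?orbT.
exists [tuple a; b; c; d] => // t; rewrite !inE -orbA.
by case/or3P=> /eqP->; rewrite (imset_triple a).
Qed.

Lemma contains_DP :
  reflect (exists a b c d e,
             [/\ uniq [:: a; b; c; d; e], [set a; b; c] \in F,
                 [set a; c; d] \in F & [set b; c; e] \in F])
          (contains F config_D).
Proof.
apply: (iffP (containsP _)) => [[s] | [a [b [c [d [e [U abc acd bce]]]]]]].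
  case/tupleP: s => a s; case/tupleP: s => b s; case/tupleP: s => c s.
  case/tupleP: s => d s; case/tupleP: s => e s.
  rewrite (tuple0 s) => U sub; exists a, b, c, d, e; split=> //.
  - have := sub (triple 5 1 2 3); rewrite (imset_triple a) //=; apply.
    by rewrite !inE eqxx.
  - have := sub (triple 5 1 3 4); rewrite (imset_triple a) //=; apply.
    by rewrite !inE eqxx ?orbT.
  - have := sub (triple 5 2 3 5); rewrite (imset_triple a) //=; apply.
    by rewrite !inE eqxx ?orbT.
exists [tuple a; b; c; d; e] => // t; rewrite !inE -orbA.
by case/or3P=> /eqP->; rewrite (imset_triple a).
Qed.

End Configurations.

(** * Bases of triples *)

Section BaseFunctions.
Variables (V : finType) (F : {set {set V}}).

(** A triple that shares no pair with another one still gets a base, chosen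
    arbitrarily, so that every triple has exactly two pairs besides its base. *)
Definition base_function (b : {set V} -> {set V}) : Prop :=
  {in F, forall e, [/\ b e \subset e, #|b e| = 2 &
     forall f p : {set V}, f \in F -> p \subset e -> p \subset f ->
       #|p| = 2 -> p != b e -> f = e]}.

Lemma card_set3 (x y z : V) : uniq [:: x; y; z] -> #|[set x; y; z]| = 3.
Proof.
move=> /card_uniqP U; rewrite -[RHS]/(size [:: x; y; z]) -U.
by apply: eq_card => u; rewrite !inE orbA.
Qed.

Lemma set3_eq (e : {set V}) (x y z : V) :
  #|e| = 3 -> uniq [:: x; y; z] -> x \in e -> y \in e -> z \in e ->
  e = [set x; y; z].
Proof.
move=> e3 /card_set3 Uxyz xe ye ze; apply/esym/eqP.
by rewrite eqEcard e3 Uxyz !subUset !sub1set xe ye ze.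
Qed.

Hypothesis F3 : triple_system F.

Lemma card_triple e : e \in F -> #|e| = 3.
Proof. by move=> eF; apply/eqP; move/forall_inP: F3; apply. Qed.

Lemma other_vertex (e p : {set V}) :
  e \in F -> p \subset e -> #|p| = 2 ->
  exists2 v, v \notin p & e = v |: p.
Proof.
move=> /card_triple e3 pe p2.
have /eqP/cards1P[v ev] : #|e :\: p| = 1 by rewrite cardsDS // e3 p2.
have : v \in e :\: p by rewrite ev set11.
rewrite inE => /andP[vp ve]; exists v => //; apply/esym/eqP.
by rewrite eqEcard subUset sub1set ve pe cardsU1 vp e3 p2.
Qed.

(** Two distinct pairs of [e] meet in one vertex [z].  With [x] and [y] their
    other vertices, the three triples are xyz, yzd and xzd': a copy of C if
    d = d' and of D otherwise. *)
Lemma no_base_conflict (e f g : {set V}) (p q : {set V}) :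
    ~~ contains F config_C -> ~~ contains F config_D ->
    e \in F -> f \in F -> g \in F -> f != e -> g != e ->
    p \subset e -> p \subset f -> q \subset e -> q \subset g ->
    #|p| = 2 -> #|q| = 2 -> p = q.
Proof.
move=> noC noD eF fF gF fe ge pe pf qe qg p2 q2.
apply/eqP; apply: contraT => pq.
have [x xp eE] := other_vertex eF pe p2.
have [y yq eE'] := other_vertex eF qe q2.
have xy : x != y.
  apply: contraNneq pq => xy.
  have -> : p = e :\ x by rewrite eE setU1K.
  by rewrite eE' xy setU1K.
have xe : x \in e by rewrite eE setU11.
have ye : y \in e by rewrite eE' setU11.
have [z zP] : exists z, z \in e :\: [set x; y].
  by apply/set0Pn; rewrite -card_gt0 cardsDS ?subUset ?sub1set ?xe // cards2 xy
    (card_triple eF).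
move: zP; rewrite !inE negb_or => /andP[/andP[zx zy] ze].
have zp : z \in p by move: ze; rewrite eE !inE (negPf zx).
have zq : z \in q by move: ze; rewrite eE' !inE (negPf zy).
have yp : y \in p by move: ye; rewrite eE !inE eq_sym (negPf xy).
have xq : x \in q by move: xe; rewrite eE' !inE (negPf xy).
have [d dp fE] := other_vertex fF pf p2.
have [d' dq gE] := other_vertex gF qg q2.
have dx : d != x by apply: contraNneq fe => dx; rewrite fE eE dx.
have dy : d' != y by apply: contraNneq ge => dy; rewrite gE eE' dy.
have [dz dNy] : d != z /\ d != y by split; apply: contraNneq dp => ->.
have [dz' dNx] : d' != z /\ d' != x by split; apply: contraNneq dq => ->.
have yxz : [set y; x; z] \in F.
  rewrite -(@set3_eq e) ?(card_triple eF) //=.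
  by rewrite !inE negb_or (eq_sym y) xy (eq_sym y) zy (eq_sym x) zx.
have [yf zf df] : [/\ y \in f, z \in f & d \in f].
  by rewrite fE !inE yp zp eqxx !orbT.
have [xg zg dg] : [/\ x \in g, z \in g & d' \in g].
  by rewrite gE !inE xq zq eqxx !orbT.
have yzd : [set y; z; d] \in F.
  rewrite -(@set3_eq f) ?(card_triple fF) //=.
  by rewrite !inE negb_or (eq_sym y) zy (eq_sym y) dNy (eq_sym z) dz.
have xzd : [set x; z; d'] \in F.
  rewrite -(@set3_eq g) ?(card_triple gF) //=.
  by rewrite !inE negb_or (eq_sym x) zx (eq_sym x) dNx (eq_sym z) dz'.
have [dd | dd] := eqVneq d d'.
  case/negP: noC; apply/contains_CP; exists y, x, d, z; split.
  - rewrite /= !inE !negb_or (eq_sym y x) xy (eq_sym y d) dNy (eq_sym y z) zy.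
    by rewrite (eq_sym x d) dx (eq_sym x z) zx dz.
  - exact: yxz.
  - by rewrite setUAC.
  - by rewrite dd setUAC.
case/negP: noD; apply/contains_DP; exists y, x, z, d, d'; split=> //.
rewrite /= !inE !negb_or (eq_sym y x) xy (eq_sym y z) zy (eq_sym y d) dNy.
by rewrite (eq_sym y d') dy (eq_sym x z) zx (eq_sym x d) dx (eq_sym x d') dNx
  (eq_sym z d) dz (eq_sym z d') dz' dd.
Qed.

Lemma exists_base_function :
  ~~ contains F config_C -> ~~ contains F config_D ->
  exists b, base_function b.
Proof.
move=> noC noD.
pose shared (e p : {set V}) := [&& p \subset e, #|p| == 2
  & [exists f in F, (f != e) && (p \subset f)]].
pose pairs (e p : {set V}) := (p \subset e) && (#|p| == 2).
exists (fun e => odflt (odflt set0 [pick p | pairs e p]) [pick p | shared e p]).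
move=> e eF; have e3 := card_triple eF.
case: (pickP (shared e)) => [p | none] /=.
  move=> /and3P[pe /eqP p2 /exists_inP[f fF /andP[fe pf]]].
  split=> // g q gF qe qg q2; apply: contraNeq => ge.
  by apply/eqP; apply: (no_base_conflict noC noD eF gF fF).
have unshared (f p : {set V}) :
    f \in F -> p \subset e -> p \subset f -> #|p| = 2 -> f = e.
  move=> fF pe pf p2; apply/eqP; apply/negPn/negP => fe.
  have /negP[] := negbT (none p); apply/and3P; split; rewrite ?p2 //.
  by apply/exists_inP; exists f; rewrite ?fe.
case: (pickP (pairs e)) => [p | none2] /=.
  move=> /andP[pe /eqP p2].
  by split=> // f q fF qe qf q2 _; apply: (unshared f q).
have : 0 < #|[set A : {set V} | A \subset e & #|A| == 2]|.
  by rewrite cards_draws e3.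
by case/card_gt0P=> p; rewrite inE => pp; have := none2 p; rewrite /pairs pp.
Qed.

(** In both configurations some triple shares two different pairs with two
    other triples, and each of them would have to be its base. *)
Lemma base_function_avoids b :
  base_function b -> ~~ contains F config_C /\ ~~ contains F config_D.
Proof.
have conflict x y z f g : base_function b -> uniq [:: x; y; z] ->
    [set x; y; z] \in F -> f \in F -> g \in F ->
    x \in f -> z \in f -> y \notin f -> y \in g -> z \in g -> x \notin g ->
    False.
  move=> bP /= /and3P[]; rewrite !inE negb_or => /andP[xy xz] yz _.
  move=> eF fF gF xf zf yf yg zg xg.
  have [_ _ own] := bP _ eF.
  have bE h u v : h \in F -> u != v -> u \in h -> v \in h ->
      h != [set x; y; z] -> u \in [set x; y; z] -> v \in [set x; y; z] ->
      [set u; v] = b [set x; y; z].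
    move=> hF uv uh vh he ue ve; apply/eqP; apply: contraNT he => ne.
    by apply/eqP; apply: own ne; rewrite // ?subUset ?sub1set ?uh ?ue ?cards2 ?uv.
  have xzE : [set x; z] = b [set x; y; z].
    apply: (bE f) => //; rewrite ?inE ?eqxx ?orbT //.
    by apply: contraNneq yf => ->; rewrite !inE eqxx ?orbT.
  have yzE : [set y; z] = b [set x; y; z].
    apply: (bE g) => //; rewrite ?inE ?eqxx ?orbT //.
    by apply: contraNneq xg => ->; rewrite !inE eqxx ?orbT.
  have : x \in [set y; z] by rewrite yzE -xzE !inE eqxx.
  by rewrite !inE (negPf xy) (negPf xz).
move=> bP; split; apply/negP.
  case/contains_CP=> x [y [w [z [/= U xyz xwz ywz]]]].
  move: U; rewrite !inE !negb_or.
  move=> /and4P[/and3P[xy xw xz] /andP[yw yz] wz _].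
  apply: (conflict x y z _ _ bP _ xyz xwz ywz);
    rewrite /= ?inE ?negb_or ?eqxx ?orbT ?xy ?xz ?yz ?yw ?xw //.
  by rewrite eq_sym xy.
case/contains_DP=> x [y [z [w [w' [/= U xyz xzw yzw]]]]].
move: U; rewrite !inE !negb_or.
move=> /and5P[/and4P[xy xz xw xw'] /and3P[yz yw yw'] _ _ _].
apply: (conflict x y z _ _ bP _ xyz xzw yzw);
  rewrite /= ?inE ?negb_or ?eqxx ?orbT ?xy ?xz ?yz ?yw ?xw' //.
by rewrite eq_sym xy.
Qed.

End BaseFunctions.

(** With [card_unowned], this turns the bound on the number of triples into
    n / 2 <= #|unowned|. *)
Lemma card_turan (n : nat) : n %/ 2 + 2 * ((n - 1) ^ 2 %/ 4) = 'C(n, 2).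
Proof.
rewrite bin2 -divn2.
have [m [->|->]] : exists m, n = m * 2 \/ n = m * 2 + 1.
- by exists (n %/ 2); lia.
- case: m => // m; have -> : (m.+1 * 2 - 1) ^ 2 = (m * m.+1) * 4 + 1.
    have -> : m.+1 * 2 - 1 = m * 2 + 1 by lia.
    by rewrite expnS expn1; lia.
  have -> : m.+1 * 2 * (m.+1 * 2).-1 = (m.+1 * (m * 2 + 1)) * 2 by lia.
  by rewrite divnMDl // !mulnK //; lia.
have -> : (m * 2 + 1 - 1) ^ 2 = (m * m) * 4 by rewrite addnK expnS expn1; lia.
have -> : (m * 2 + 1) * (m * 2 + 1).-1 = ((m * 2 + 1) * m) * 2 by lia.
by rewrite !mulnK //; lia.
Qed.

(** * Pairs without an owner, and the upper bound *)

Section Unowned.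
Variables (V : finType) (F : {set {set V}}) (b : {set V} -> {set V}).
Hypotheses (F3 : triple_system F) (bP : base_function F b).

Definition own (e : {set V}) : {set {set V}} :=
  [set p in [set p : {set V} | p \subset e & #|p| == 2] | p != b e].

(** This contains the bases and also the pairs that lie in no triple. *)
Definition unowned : {set {set V}} :=
  [set p : {set V} | #|p| == 2] :\: \bigcup_(e in F) own e.

Lemma base_sub (e : {set V}) : e \in F -> b e \subset e.
Proof. by case/bP. Qed.

Lemma card_base (e : {set V}) : e \in F -> #|b e| = 2.
Proof. by case/bP. Qed.

Lemma own_inj (e f p : {set V}) :
  e \in F -> f \in F -> p \in own e -> p \subset f -> f = e.
Proof.
move=> eF fF; rewrite !inE => /andP[/andP[pe /eqP p2] pb] pf.
by have [_ _ own] := bP eF; apply: own pf p2 pb.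
Qed.

Lemma card_own (e : {set V}) : e \in F -> #|own e| = 2.
Proof.
move=> eF; have := cards_draws e 2.
rewrite (card_triple F3 eF) (cardsD1 (b e)) !inE base_sub // card_base //=.
rewrite (_ : 'C(3, 2) = 3) // add1n => -[<-].
by apply: eq_card => p; rewrite !inE andbC.
Qed.

(** Every triple owns two pairs, and no pair is owned twice. *)
Lemma card_unowned : #|unowned| + 2 * #|F| = 'C(#|V|, 2).
Proof.
rewrite -card_draws -[RHS](cardsID (\bigcup_(e in F) own e)) [RHS]addnC.
congr (_ + _).
have -> : [set A : {set V} | #|A| == 2] :&: \bigcup_(e in F) own e
          = \bigcup_(e in F) own e.
  apply/setIidPr/subsetP => p /bigcupP[e _].
  by rewrite !inE => /andP[/andP[_ ->]].
rewrite mulnC -sum_nat_const (eq_bigr (fun e => \sum_(p in own e) 1)); last first.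
  by move=> e eF; rewrite sum1_card card_own.
rewrite (exchange_big_dep (mem (\bigcup_(e in F) own e))) /=; last first.
  by move=> e p eF pe; apply/bigcupP; exists e.
rewrite -[RHS]sum1_card; apply: eq_bigr => p /bigcupP[e eF pe].
rewrite (big_pred1 e) // => f /=; apply/andP/eqP => [[fF pf]|->//].
apply: own_inj eF fF pe _.
by move: pf; rewrite !inE => /andP[/andP[]].
Qed.

Lemma card_of_unowned (p : {set V}) : p \in unowned -> #|p| = 2.
Proof. by rewrite !inE => /andP[_ /eqP]. Qed.

Lemma base_unowned (e : {set V}) : e \in F -> b e \in unowned.
Proof.
move=> eF; rewrite !inE card_base // eqxx andbT.
apply/bigcupP => -[f fF bef].
have ef := own_inj fF eF bef (base_sub eF).
by move: bef; rewrite -ef !inE eqxx andbF.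
Qed.

Lemma ownedP (p : {set V}) :
  #|p| = 2 -> p \notin unowned -> exists2 e, e \in F & p \in own e.
Proof.
by move=> p2; rewrite !inE p2 andbT negbK => /bigcupP[e]; exists e.
Qed.

Lemma owned_uniq (p e f : {set V}) : #|p| = 2 -> p \notin unowned ->
  e \in F -> f \in F -> p \subset e -> p \subset f -> e = f.
Proof.
move=> p2 /(ownedP p2)[g gF pg] eF fF pe pf.
by rewrite (own_inj gF eF pg pe) (own_inj gF fF pg pf).
Qed.

(** A pair owned by [e] is not its base, so it consists of one vertex of the
    base [p] and the vertex of [e] outside [p], the apex of [e]. *)
Lemma owned_apex (x y : V) : x != y -> [set x; y] \notin unowned ->
  exists2 e, e \in F & exists2 p, p \in unowned &
    [/\ x \in p, y \notin p & e = y |: p] \/ [/\ y \in p, x \notin p & e = x |: p].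
Proof.
move=> xy xyO; have [|e eF xye] := ownedP _ xyO; first by rewrite cards2 xy.
exists e => //; exists (b e); first exact: base_unowned.
have [v vb ev] := other_vertex F3 eF (base_sub eF) (card_base eF).
move: xye; rewrite !inE subUset !sub1set => /andP[/andP[/andP[xe ye] _]].
have [xv | xv] := eqVneq x v.
  move=> _; right; rewrite xv; split=> //.
  by move: ye; rewrite {1}ev !inE -xv eq_sym (negPf xy).
have xb : x \in b e by move: xe; rewrite {1}ev !inE (negPf xv).
have [yv | yv] := eqVneq y v.
  by move=> _; left; rewrite yv.
have yb : y \in b e by move: ye; rewrite {1}ev !inE (negPf yv).
by rewrite eqEcard subUset !sub1set xb yb card_base // cards2 xy.
Qed.

(** The owner of [uw] has its base in [unowned]; as [u] is in no such pair, it
    must be the apex. *)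
Lemma unowned_cover_other (u w : V) : u \notin cover unowned -> w != u ->
  exists2 p, p \in unowned & w \in p /\ u |: p \in F.
Proof.
move=> uO wu; have out (p : {set V}) : p \in unowned -> u \notin p.
  by move=> pO; apply: contra uO => up; apply/bigcupP; exists p.
have [|e eF [p pO [[wp up eE] | [up]]]] := owned_apex wu.
- by apply/negP => /out; rewrite !inE eqxx orbT.
- by exists p => //; rewrite -eE.
- by have := out p pO; rewrite up.
Qed.

(** If a vertex is uncovered, [unowned_cover_other] covers all the others. *)
Lemma leq_cover_unowned : #|V| <= #|cover unowned|.+1.
Proof.
have [all | ] := boolP ([set: V] \subset cover unowned).
  by rewrite -cardsT; apply: leq_trans (subset_leq_card all) _.
case/subsetPn=> u _ uO; rewrite -cardsT (cardsD1 u) in_setT ltnS.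
apply/subset_leq_card/subsetP => w; rewrite !inE andbT => wu.
by have [p pO [wp _]] := unowned_cover_other uO wu; apply/bigcupP; exists p.
Qed.

Lemma sum_card_pairs (P : {set {set V}}) :
  {in P, forall p : {set V}, #|p| = 2} -> \sum_(p in P) #|p| = #|P| * 2.
Proof. by move=> P2; rewrite -sum_nat_const; apply: eq_bigr. Qed.

Lemma leq_card_unowned : #|V| %/ 2 <= #|unowned|.
Proof.
have := leq_card_cover unowned; rewrite sum_card_pairs; last exact: card_of_unowned.
move=> [le _]; have := leq_cover_unowned; lia.
Qed.

Lemma leq_card_based : #|F| <= (#|V| - 1) ^ 2 %/ 4.
Proof.
by have := leq_card_unowned; have := card_unowned; have := card_turan #|V|; lia.
Qed.

Lemma card_extremal :
  (#|F| == (#|V| - 1) ^ 2 %/ 4) = (#|unowned| == #|V| %/ 2).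
Proof. by have := card_unowned; have := card_turan #|V|; lia. Qed.

(** * The extremal systems *)

Hypothesis unowned_min : #|unowned| = #|V| %/ 2.

(** For an uncovered vertex [u], the pairs [p] with [u |: p] in [F] are disjoint,
    since a pair [uw] has only one owner, and they cover all vertices but [u].
    So the number of vertices is odd. *)
Lemma unowned_cover_even : ~~ odd #|V| -> cover unowned = setT.
Proof.
move=> evenV; apply/eqP; rewrite eqEsubset subsetT /=.
apply: contraT => /subsetPn[u _ uO].
have out (p : {set V}) : p \in unowned -> u \notin p.
  by move=> pO; apply: contra uO => up; apply/bigcupP; exists p.
pose L := [set p in unowned | u |: p \in F].
have covL : cover L = [set~ u].
  apply/setP => w; rewrite !inE; apply/bigcupP/idP => [[p]|wu].
    by rewrite inE => /andP[/out up _] wp; apply: contraNneq up => <-.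
  have [p pO [wp uF]] := unowned_cover_other uO wu.
  by exists p; rewrite // inE pO.
have trivL : trivIset L.
  apply/trivIsetP => p q; rewrite ![_ \in L]inE => /andP[pO uF] /andP[qO uF'] pq.
  rewrite -setI_eq0; apply: contraR pq => /set0Pn[w]; rewrite inE => /andP[wp wq].
  have wu : u != w by apply: contraTneq wp => <-; exact: out.
  have eE : u |: p = u |: q.
    apply: (@owned_uniq [set u; w]); rewrite ?cards2 ?wu //.
    - by apply/negP => /out; rewrite !inE eqxx.
    - by rewrite subUset !sub1set !inE eqxx wp orbT.
    - by rewrite subUset !sub1set !inE eqxx wq orbT.
  by rewrite -(setU1K (out p pO)) eE setU1K ?out.
have := leq_card_cover L; rewrite covL trivL sum_card_pairs; last first.
  by move=> p; rewrite inE => /andP[/card_of_unowned].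
move=> [_ /eqP]; have := cardsC1 u; have : 0 < #|V| by apply/card_gt0P; exists u.
by move: evenV; lia.
Qed.

(** [unowned] has so few pairs that the union bound on the number of vertices
    that they cover is attained. *)
Lemma unowned_trivIset : trivIset unowned.
Proof.
have := leq_card_cover unowned; rewrite sum_card_pairs; last exact: card_of_unowned.
move=> [le <-]; have := leq_cover_unowned; rewrite eqn_leq le /= unowned_min.
have [oddV | /unowned_cover_even ->] := boolP (odd #|V|).
  by move: oddV; move: #|cover _| #|V| => c n; lia.
by rewrite cardsT; lia.
Qed.

Lemma unowned_maximum_matching : maximum_matching unowned.
Proof.
apply/and3P; split; rewrite ?unowned_trivIset ?unowned_min //.
by apply/forall_inP => p /card_of_unowned ->.
Qed.

Lemma unowned_block (p q : {set V}) (x : V) : p \in unowned -> q \in unowned ->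
  x \in p -> x \in q -> p = q.
Proof.
move=> pO qO xp xq.
by rewrite -(def_pblock unowned_trivIset pO xp) (def_pblock unowned_trivIset qO xq).
Qed.

(** One vertex [v] of [e'] is enough: if [unowned] is a maximum matching that
    contains [e] and [e'], then both vertices of [e'] form a triple with [e]. *)
Definition arrow (e e' : {set V}) : bool := [exists v in e', v |: e \in F].

Lemma apex_notin (p : {set V}) (v : V) : #|p| = 2 -> v |: p \in F -> v \notin p.
Proof. by move=> p2 /(card_triple F3); rewrite cardsU1 p2; case: (v \in p). Qed.

(** The pair [xy] meets the member [p] of the matching in [x] only, so it has an
    owner, whose base is [p] or the member of the matching that contains [y]. *)
Lemma matched_apex (p : {set V}) (x y : V) : p \in unowned -> x \in p -> y \notin p ->
  y |: p \in F \/ exists q, [/\ q \in unowned, y \in q & x |: q \in F].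
Proof.
move=> pO xp yp; have xy : x != y by apply: contraNneq yp => <-.
have [|e eF [q qO [[xq yq eE] | [yq xq eE]]]] := owned_apex xy.
- apply: contra yp => xyO; rewrite (unowned_block pO xyO xp) !inE eqxx ?orbT //.
- by left; rewrite (unowned_block pO qO xp xq) -eE.
- by right; exists q; rewrite -eE.
Qed.

(** Arrows in both directions between [p] and [q] would give the pair [wv] with
    [w] in [p] and [v] in [q] two triples, [v |: p] and [w |: q]; and
    [matched_apex] gives an arrow in one direction. *)
Lemma arrow_tournament : tournament unowned arrow.
Proof.
split=> [p pO | p q pO qO pq].
  apply/exists_inP => -[v vp] /(apex_notin (card_of_unowned pO)).
  by rewrite vp.
have meet x : x \in p -> x \in q -> False.
  by move=> xp xq; case/eqP: pq; apply: unowned_block xp xq.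
apply/idP/idP => [/exists_inP[v vq vF] | ].
  apply/exists_inP => -[w wp wF].
  have wv : w != v by apply/eqP => wv; apply: (meet w) => //; rewrite wv.
  have eE : v |: p = w |: q.
    apply: (@owned_uniq [set w; v]); rewrite ?cards2 ?wv //.
    - apply/negP => wvO; apply: (meet v) => //.
      by rewrite (unowned_block pO wvO wp) !inE eqxx ?orbT.
    - by rewrite subUset !sub1set !inE eqxx wp orbT.
    - by rewrite subUset !sub1set !inE eqxx vq orbT.
  have : #|p :|: q| <= 3.
    rewrite -(card_triple F3 vF); apply: subset_leq_card.
    by rewrite subUset subsetUr eE subsetUr.
  have /eqP pq0 : p :&: q == set0.
    by apply/set0Pn => -[x]; rewrite inE => /andP[]; apply: meet.
  by rewrite cardsU pq0 cards0 !card_of_unowned.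
have [x xp] : exists x, x \in p by apply/card_gt0P; rewrite card_of_unowned.
have [y yq] : exists y, y \in q by apply/card_gt0P; rewrite card_of_unowned.
move=> /exists_inPn noqp; apply/exists_inP; exists y => //.
have yp : y \notin p by apply/negP => yp; apply: (meet y).
have [//|[r [rO yr xF]]] := matched_apex pO xp yp.
by have := noqp x xp; rewrite (unowned_block qO rO yq yr) xF.
Qed.

Lemma unowned_tournament_system : F = tournament_system unowned arrow.
Proof.
apply/setP => e; apply/idP/imset2P => [eF | [p v pO]].
  have [v vb eE] := other_vertex F3 eF (base_sub eF) (card_base eF).
  exists (b e) v => //; first exact: base_unowned.
  rewrite inE; have [/bigcupP[q qO vq] | vO] := boolP (v \in cover unowned).
    apply/orP; left; apply/exists_inP; exists q => //; rewrite vq andbT.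
    by apply/exists_inP; exists v; rewrite // -eE.
  rewrite andbT orbC; apply/orP; left; apply: contraNT vO => /unowned_cover_even ->.
  by rewrite in_setT.
have [x xp] : exists x, x \in p by apply/card_gt0P; rewrite card_of_unowned.
rewrite inE => vP ->; have vp : v \notin p.
  apply/negP => vp.
  case/orP: vP => [/exists_inP[q qO /andP[pq vq]] | /andP[_ /bigcupP[]]].
    move: pq; rewrite -(unowned_block pO qO vp vq) => pp.
    by have [/(_ p pO)] := arrow_tournament; rewrite pp.
  by exists p.
have [//|[r [rO vr xF]]] := matched_apex pO xp vp.
case/orP: vP => [/exists_inP[q qO /andP[pq vq]] | /andP[_ /bigcupP[]]]; last by exists r.
have rq := unowned_block rO qO vr vq; rewrite {}rq in xF.
have pNq : p != q by apply: contraNneq vp => ->.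
have [_ /(_ p q pO qO pNq)] := arrow_tournament; rewrite pq => /esym/exists_inPn.
by move/(_ x xp); rewrite xF.
Qed.

(** A cyclic triangle x -> y -> z -> x gives triples [v |: x], [w |: y] and
    [u |: z] with [v], [w], [u] in [y], [z], [x]: a copy of A with corners [u],
    [v] and [w]. *)
Lemma arrow_transitive :
  ~~ contains F config_A -> {in unowned & &, transitive arrow}.
Proof.
move=> noA y x z yO xO zO xy yz.
have [irr anti] := arrow_tournament.
have xNy : x != y by apply: contraTneq xy => ->; apply: irr.
have yNz : y != z by apply: contraTneq yz => ->; apply: irr.
have xNz : x != z.
  by apply: contraTneq xy => ->; rewrite -anti // eq_sym.
apply: contraR noA; rewrite -anti // 1?eq_sym // => zx.
case/exists_inP: xy => v vy vF; case/exists_inP: yz => w wz wF.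
case/exists_inP: zx => u ux uF.
have mate p s : p \in unowned -> s \in p -> exists2 t, t != s & p = [set s; t].
  move=> pO sp; have := card_of_unowned pO; rewrite (cardsD1 s) sp => -[/eqP].
  case/cards1P=> t tE; exists t; last by rewrite -tE setD1K.
  by have := set11 t; rewrite -tE !inE => /andP[].
have [u' uu' xE] := mate x u xO ux; have [v' vv' yE] := mate y v yO vy.
have [w' ww' zE] := mate z w zO wz.
have apart p q s t : p \in unowned -> q \in unowned -> p != q ->
    s \in p -> t \in q -> s != t.
  by move=> pO qO pq sp tq; apply: contraNneq pq => st;
     rewrite (unowned_block pO qO sp) ?st.
have u'x : u' \in x by rewrite xE !inE eqxx orbT.
have v'y : v' \in y by rewrite yE !inE eqxx orbT.
have w'z : w' \in z by rewrite zE !inE eqxx orbT.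
have Axy s t := apart x y s t xO yO xNy; have Ayz s t := apart y z s t yO zO yNz.
have Axz s t := apart x z s t xO zO xNz.
apply/contains_AP; exists u, v, w, u', w', v'; split.
- rewrite /= !inE !negb_or ![u == u']eq_sym ![v == v']eq_sym ![w == w']eq_sym.
  rewrite uu' vv' ww' ![w == u']eq_sym ![w == v']eq_sym ![v == u']eq_sym.
  rewrite ![w' == v']eq_sym (Axy u v) ?(Axy u v') ?(Axy u' v) ?(Axy u' v') //.
  rewrite (Ayz v w) ?(Ayz v w') ?(Ayz v' w) ?(Ayz v' w') //.
  by rewrite (Axz u w) ?(Axz u w') ?(Axz u' w) ?(Axz u' w').
- by rewrite setUAC -xE setUC.
- by rewrite -setUA -zE.
- by rewrite setUAC -yE setUC.
Qed.

End Unowned.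

(** * Tournament systems *)

Section TournamentSystems.
Variables (V : finType) (M : {set {set V}}) (T : rel {set V}).
Hypotheses (Mmax : maximum_matching M) (Ttour : tournament M T).

(** The vertices that form a triple with [p]; an unmatched vertex counts as
    dominated by every matching pair. *)
Definition above (p : {set V}) (v : V) : bool :=
  [exists q in M, T p q && (v \in q)] || (odd #|V| && (v \notin cover M)).

Definition matching_base (e : {set V}) : {set V} :=
  odflt set0 [pick p | (p \in M) && (p \subset e)].

Lemma card_matching_pair (p : {set V}) : p \in M -> #|p| = 2.
Proof. by case/and3P: Mmax => /forall_inP M2 _ _ /M2/eqP. Qed.

Lemma matching_block (p q : {set V}) (x : V) : p \in M -> q \in M ->
  x \in p -> x \in q -> p = q.
Proof.
case/and3P: Mmax => _ trivM _ pM qM xp xq.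
by rewrite -(def_pblock trivM pM xp) (def_pblock trivM qM xq).
Qed.

Lemma card_uncovered : #|~: cover M| = odd #|V|.
Proof.
case/and3P: Mmax => _ trivM /eqP cardM.
have := leq_card_cover M; rewrite trivM sum_card_pairs; last exact: card_matching_pair.
move=> [_ /eqP]; have := cardsC (cover M); rewrite cardM -modn2.
by move: #|cover M| #|~: cover M| #|V| => c d n; lia.
Qed.

Lemma above_block (p q : {set V}) (v : V) :
  above p v -> q \in M -> v \in q -> T p q.
Proof.
case/orP=> [/exists_inP[r rM /andP[pr vr]] qM vq | /andP[_ vM] qM vq].
  by rewrite -(matching_block rM qM vr vq).
by case/bigcupP: vM; exists q.
Qed.

Lemma above_notin (p : {set V}) (v : V) : p \in M -> above p v -> v \notin p.
Proof.
move=> pM pv; apply/negP => /(above_block pv pM).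
by case: Ttour => /(_ p pM)/negPf->.
Qed.

Lemma tournament_systemP (e : {set V}) :
  reflect (exists p v, [/\ p \in M, above p v, v \notin p & e = v |: p])
          (e \in tournament_system M T).
Proof.
apply: (iffP (imset2P)) => [[p v pM] | [p [v [pM pv _ ->]]]].
  by rewrite inE => pv ->; exists p, v; split; rewrite ?above_notin.
by exists p v; rewrite ?inE.
Qed.

Lemma tournament_triple_system : triple_system (tournament_system M T).
Proof.
apply/forall_inP => _ /tournament_systemP[p [v [pM _ vp ->]]].
by rewrite cardsU1 vp card_matching_pair.
Qed.

Lemma matching_base_eq (p : {set V}) (v : V) :
  p \in M -> matching_base (v |: p) = p.
Proof.
move=> pM; rewrite /matching_base; case: pickP => [q /andP[qM qp] | /(_ p)] /=.
  apply/eqP; apply: contraT => qNp.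
  have : q \subset [set v].
    apply/subsetP => x xq; move/subsetP/(_ x xq): qp; rewrite !inE.
    case/orP=> // xp; case/eqP: qNp; exact: matching_block xq xp.
  by move/subset_leq_card; rewrite cards1 card_matching_pair.
by rewrite pM subsetUr.
Qed.

(** A pair xv other than the base p of [v |: p], with x in p, could lie in
    another triple only as the triple [x |: q] with v in q, which would reverse
    the arrow from p to q. *)
Lemma tournament_base_function :
  base_function (tournament_system M T) matching_base.
Proof.
move=> _ /tournament_systemP[p [v [pM pv vp ->]]].
rewrite matching_base_eq // subsetUr card_matching_pair //; split=> //.
move=> _ r /tournament_systemP[q [w [qM qw wq ->]]] re rf r2 rNp.
have vr : v \in r.
  apply: contraNT rNp => vr; rewrite eqEcard r2 card_matching_pair // andbT.
  apply/subsetP => x xr; move/subsetP/(_ x xr): re; rewrite !inE.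
  by case/orP=> // /eqP xv; rewrite -xv xr in vr.
have [x xrv] : exists x, x \in r :\ v.
  by apply/card_gt0P; move: r2; rewrite (cardsD1 v) vr; case: #|_|.
move: xrv; rewrite !inE => /andP[xv xr].
have xp : x \in p by move/subsetP/(_ x xr): re; rewrite !inE (negPf xv).
have : v \in w |: q by move/subsetP/(_ v vr): rf.
have [<- | pNq] := eqVneq p q.
  by rewrite !inE (negPf vp) orbF => /eqP->.
have xw : x = w.
  move/subsetP/(_ x xr): rf; rewrite !inE => /orP[/eqP//|xq].
  by case/eqP: pNq; apply: matching_block xp xq.
rewrite !inE -xw eq_sym (negPf xv) /= => vq.
have pq := above_block pv qM vq.
have qp : T q p by apply: (above_block qw); rewrite -?xw.
by case: Ttour => _ /(_ p q pM qM pNq); rewrite pq qp.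
Qed.

(** Two vertices that are not matched to each other lie in a triple: if both are
    matched, the arrow between their matching pairs provides it, and at most
    one vertex is unmatched. *)
Lemma unowned_sub_matching :
  unowned (tournament_system M T) matching_base \subset M.
Proof.
apply/subsetP => r; rewrite !inE => /andP[rO /eqP r2].
apply: contraNT rO => rM.
have key p x y : p \in M -> x \in p -> x \in r -> y \in r -> above p y ->
    r \in \bigcup_(e in tournament_system M T) own matching_base e.
  move=> pM xp xr yr py; have yp := above_notin pM py.
  have xy : y != x by apply: contraNneq yp => ->.
  apply/bigcupP; exists (y |: p); first by apply/tournament_systemP; exists p, y.
  have -> : r = [set y; x].
    by apply/esym/eqP; rewrite eqEcard subUset !sub1set xr yr cards2 xy r2.
  rewrite !inE subUset !sub1set !inE eqxx xp orbT cards2 xy /= matching_base_eq //.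
  by apply: contraNneq yp => <-; rewrite !inE eqxx.
have /eqP/cards2P[x [y [xy rE]]] := r2.
have [xr yr] : x \in r /\ y \in r by rewrite rE !inE !eqxx orbT.
have oddV z : z \notin cover M -> odd #|V|.
  move=> zM; have := card_uncovered; case: (odd _) => // /eqP.
  by rewrite cards_eq0 => /eqP/setP/(_ z); rewrite !inE zM.
have [/bigcupP[p pM xp] | xM] := boolP (x \in cover M).
  have [yM | yM] := boolP (y \in cover M); last first.
    by apply: (key p x y) => //; rewrite /above yM (oddV y yM) orbT.
  have /bigcupP[q qM yq] := yM.
  have pq : p != q.
    apply: contraNneq rM => pq.
    suff -> : r = p by [].
    apply/eqP; rewrite eqEcard rE subUset !sub1set xp pq yq.
    by rewrite -rE r2 -pq card_matching_pair.
  case: Ttour => _ /(_ p q pM qM pq); case: (boolP (T q p)) => [Tqp _ | _ Tpq].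
    apply: (key q y x) => //; apply/orP; left; apply/exists_inP.
    by exists p; rewrite ?Tqp.
  apply: (key p x y) => //; apply/orP; left; apply/exists_inP.
  by exists q; rewrite ?Tpq.
have [/bigcupP[q qM yq] | yM] := boolP (y \in cover M).
  by apply: (key q y x) => //; rewrite /above xM (oddV x xM) orbT.
have : #|r| <= #|~: cover M|.
  by apply: subset_leq_card; rewrite rE subUset !sub1set !inE xM yM.
by rewrite r2 card_uncovered; case: (odd _).
Qed.

(** The unowned pairs are at least as many as the matching pairs, and they are
    matching pairs, so that [card_extremal] applies. *)
Lemma card_tournament_system :
  #|tournament_system M T| = (#|V| - 1) ^ 2 %/ 4.
Proof.
apply/eqP; rewrite (card_extremal tournament_triple_system tournament_base_function).
rewrite eqn_leq (leq_card_unowned tournament_triple_system tournament_base_function).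
case/and3P: Mmax => _ _ /eqP <-.
by rewrite (subset_leq_card unowned_sub_matching).
Qed.

Lemma tournament_tripleP (x y z : V) :
    uniq [:: x; y; z] -> [set x; y; z] \in tournament_system M T ->
  [\/ [set x; y] \in M /\ above [set x; y] z,
      [set x; z] \in M /\ above [set x; z] y
    | [set y; z] \in M /\ above [set y; z] x].
Proof.
move=> U /tournament_systemP[p [v [pM pv vp eE]]].
have pE : p = [set x; y; z] :\ v by rewrite eE setU1K.
have : v \in [set x; y; z] by rewrite eE setU11.
move: U; rewrite /= !inE negb_or => /and3P[/andP[xy xz] yz _].
rewrite -orbA => /or3P[]/eqP vE; rewrite vE in pE pv.
- constructor 3; rewrite -(_ : p = [set y; z]) // pE.
  apply/setP => u; rewrite !inE; have [->|] //= := eqVneq u x.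
  by rewrite (negPf xy) (negPf xz).
- constructor 2; rewrite -(_ : p = [set x; z]) // pE.
  apply/setP => u; rewrite !inE; have [->|] //= := eqVneq u y.
  by rewrite eq_sym (negPf xy) (negPf yz).
  by rewrite orbF.
- constructor 1; rewrite -(_ : p = [set x; y]) // pE.
  apply/setP => u; rewrite !inE; have [->|] //= := eqVneq u z.
  by rewrite ![z == _]eq_sym (negPf xz) (negPf yz).
  by rewrite orbF.
Qed.

Hypothesis Ttrans : {in M & &, transitive T}.

(** Closes the cases where two matching pairs share exactly one vertex, wherever
    that vertex is written in each pair. *)
Ltac clash partner H K :=
  let go L := (solve [apply: L H K _; rewrite // eq_sym //]) in
  first [ go (partner) | rewrite setUC in H; go (partner)
        | rewrite setUC in K; go (partner)
        | rewrite setUC in H; rewrite setUC in K; go (partner) ].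

(** Each of the three triples contains a matching pair, and these three pairs are
    disjoint.  This leaves the cases where the pairs are ad, ce, bf or bd, ae,
    cf: there every corner is the apex of one triple and in the base of
    another, and so the three pairs form a cyclic triangle. *)
Lemma tournament_avoids_A : ~~ contains (tournament_system M T) config_A.
Proof.
apply/negP => /contains_AP[a [b [c [d [e [f [U abd ace bcf]]]]]]].
have partner u v w : [set u; v] \in M -> [set u; w] \in M -> v != w -> False.
  move=> uv uw vw; have : v \in [set u; w].
    by rewrite -(@matching_block _ _ u uv uw) !inE eqxx ?orbT.
  rewrite !inE (negPf vw) orbF => /eqP vu.
  by have := card_matching_pair uv; rewrite vu cards2 eqxx.
have acyclic p q r : p \in M -> q \in M -> r \in M ->
    T p q -> T q r -> T r p -> False.
  move=> pM qM rM pq qr rp.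
  have pp : T p p by apply: Ttrans rp => //; apply: Ttrans qr.
  by case: Ttour => /(_ p pM); rewrite pp.
move: U; rewrite /= !inE !negb_or.
case/and5P=> /and5P[ab ac ad ae af] /and4P[bc bd be bf] /and3P[cd ce cf].
move=> /andP[de df] /andP[ef _].
(* The three choices of the matching pair in each of the three triples. *)
have [|[M1 A1]|[M1 A1]|[M1 A1]] := tournament_tripleP _ abd;
  first (by rewrite /= !inE negb_or ab ad bd);
have [|[M2 A2]|[M2 A2]|[M2 A2]] := tournament_tripleP _ ace;
  try (by rewrite /= !inE negb_or ac ae ce);
  try clash partner M1 M2;
have [|[M3 A3]|[M3 A3]|[M3 A3]] := tournament_tripleP _ bcf;
  try (by rewrite /= !inE negb_or bc bf cf);
  try clash partner M1 M3; try clash partner M2 M3.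
- apply: (acyclic _ _ _ M1 M3 M2).
  + by apply: above_block A1 M3 _; rewrite !inE eqxx.
  + by apply: above_block A3 M2 _; rewrite !inE eqxx.
  + by apply: above_block A2 M1 _; rewrite !inE eqxx.
- apply: (acyclic _ _ _ M1 M2 M3).
  + by apply: above_block A1 M2 _; rewrite !inE eqxx.
  + by apply: above_block A2 M3 _; rewrite !inE eqxx.
  + by apply: above_block A3 M1 _; rewrite !inE eqxx.
Qed.

End TournamentSystems.

(** * Sharpness and the theorem *)

(** The pairs of consecutive numbers 2i, 2i + 1. *)
Lemma exists_maximum_matching (n : nat) :
  exists M : {set {set 'I_n}}, maximum_matching M.
Proof.
pose p (i : 'I_(n %/ 2)) := [set u : 'I_n | u %/ 2 == i].
have p2 i : #|p i| = 2.
  have i0 : 2 * i < n by case: i => i /=; lia.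
  have i1 : 2 * i + 1 < n by case: i {i0} => i /=; lia.
  have -> : p i = [set Ordinal i0; Ordinal i1].
    by apply/setP => u; rewrite !inE -!val_eqE /=; lia.
  by rewrite cards2 -val_eqE /=; lia.
have p_inj : injective p.
  move=> i j ij; have /card_gt0P[u ui] : 0 < #|p i| by rewrite p2.
  have uj : u \in p j by rewrite -ij.
  by apply: val_inj; move: ui uj; rewrite !inE /= => /eqP <- /eqP.
exists [set p i | i : 'I_(n %/ 2)]; apply/and3P; split.
- by apply/forall_inP => _ /imsetP[i _ ->]; rewrite p2.
- apply/trivIsetP => _ _ /imsetP[i _ ->] /imsetP[j _ ->] pij.
  rewrite -setI_eq0; apply: contraR pij => /set0Pn[u].
  rewrite !inE => /andP[/eqP ui /eqP uj]; apply/eqP; congr p.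
  by apply: val_inj; rewrite /= -ui.
- by rewrite card_imset // !card_ord.
Qed.

Lemma rank_transitive_tournament (V : finType) (M : {set {set V}}) :
  transitive_tournament M (fun p q => enum_rank p < enum_rank q).
Proof.
split; [split=> [p _ | p q _ _ pq] | by move=> q p r _ _ _; apply: ltn_trans].
  by rewrite ltnn.
rewrite -leqNgt ltn_neqAle; case: eqP => // /val_inj/enum_rank_inj.
by move/eqP: pq.
Qed.

Theorem corollary9 (n : nat) (n_gt0 : 0 < n) :
  turan_ex n [:: config_A; config_C; config_D] = (n - 1) ^ 2 %/ 4 /\
  (forall (V : finType) (F : {set {set V}}),
     #|V| = n -> triple_system F ->
     avoids F [:: config_A; config_C; config_D] ->
     (#|F| = (n - 1) ^ 2 %/ 4 <->
      exists (M : {set {set V}}) (T : rel {set V}),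
        [/\ maximum_matching M, transitive_tournament M T
          & F = tournament_system M T])).
Proof.
split.
  apply/eqP; rewrite eqn_leq; apply/andP; split.
    apply/bigmax_leqP => F /andP[F3 /and4P[_ noC noD _]].
    have [b bP] := exists_base_function F3 noC noD.
    by have := leq_card_based F3 bP; rewrite card_ord.
  have [M Mmax] := exists_maximum_matching n.
  have [Ttour Ttrans] := rank_transitive_tournament M.
  have := card_tournament_system Mmax Ttour; rewrite card_ord => <-.
  apply: (leq_bigmax_cond (F := fun F : {set {set 'I_n}} => #|F|)).
  have F3 := tournament_triple_system Mmax Ttour.
  have [noC noD] := base_function_avoids (tournament_base_function Mmax Ttour).
  by rewrite F3 /avoids /= noC noD tournament_avoids_A.
move=> V F <- F3 /and4P[noA noC noD _].
have [b bP] := exists_base_function F3 noC noD.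
split=> [/eqP | [M [T [Mmax [Ttour _] ->]]]]; last exact: card_tournament_system.
rewrite (card_extremal F3 bP) => /eqP unowned_min.
exists (unowned F b), (arrow F); split.
- exact: unowned_maximum_matching.
- by split; [apply: arrow_tournament | apply: arrow_transitive].
- exact: unowned_tournament_system.
Qed.
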